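(* Let $\mathcal{O}$ be an unstable cycle of length $T$ of a dynamical system $f:\hat{\mathbb{C}}\to\hat{\mathbb{C}}$, with multiplier $\mu(\mathcal{O})=\mu$. Then the set of complex numbers $\langle a\rangle=\{a_1,a_2,\dots,a_n\}$ stabilizes locally this cycle if and only if the polynomial $$q_{1/T}(z)=a_1z+a_2z^{T+1}+a_3z^{2T+1}+\dots+a_nz^{(n-1)T+1}$$ omits the values $\mu^{-1/T}$ in the closed unit disk $\bar\Delta$, i.e. there is no $z\in\bar\Delta$ such that $(q_{1/T}(z))^T=1/\mu$.
   Context: $\Delta=\{z\in\mathbb{C}:|z|<1\}$, $\bar\Delta$ is its closure, $\hat{\mathbb{C}}=\mathbb{C}\cup\{\infty\}$ is the Riemann sphere and $f$ is holomorphic. A cycle of length $T$ is an orbit $\mathcal{O}=(s,f(s),\dots,f^{T-1}(s))$ with $f^T(s)=s$, $T$ minimal; its multiplier is $\mu(\mathcal{O})=(f^T)'(s)$; the cycle is unstable (repelling) if its multiplier lies outside the unit disk. Throughout, an averaging set $\langle a\rangle=\{a_1,\dots,a_n\}$ is a finite sequence of complex numbers with $a_1+\dots+a_n=1$ and $a_1\ne0$. Put $p(z)=a_n+a_{n-1}z+\dots+a_1z^{n-1}$ and $$\chi_T(z)=z^{(n-1)T+1}-\mu\,(p(z))^T.$$ By definition, $\langle a\rangle$ stabilizes locally the cycle $\mathcal{O}$ of length $T$ and multiplier $\mu$ if and only if all roots of $\chi_T$ lie in $\Delta$. *)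

(* Defs.v *)
From HB Require Import structures.
From mathcomp Require Export all_boot all_order all_algebra.
From mathcomp Require Export all_classical reals topology normedtype derive.
From mathcomp Require Export complex.

Set Implicit Arguments.
Unset Strict Implicit.
Unset Printing Implicit Defensive.

Export Order.TTheory GRing.Theory Num.Theory.
Export numFieldNormedType.Exports.

Local Open Scope classical_set_scope.
Local Open Scope ring_scope.

(* R[i]^o is R[i] viewed as a normed module over itself, so that [derivable]
   and [derive1] below mean complex differentiability and the complex
   derivative. *)
Definition Cplx (R : realType) := R[i]^o.

(* None is the point at infinity. *)
Definition Sphere (R : realType) := one_point_compactification (Cplx R).

Section RiemannSphere.
Variable R : realType.
Local Notation C := (Cplx R).
Local Notation S := (Sphere R).

(* The chart at p: z on the complex plane for p finite, 1/z on the complement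
   of 0 for p = oo. Points outside of the domain of the chart are sent to the
   junk value 0; this is only used near p. *)
Definition chart (p : S) : S -> C :=
  if p is Some _ then fun x => if x is Some z then z else 0
  else fun x => if x is Some z then z^-1 else 0.

Definition chart_inv (p : S) : C -> S :=
  if p is Some _ then fun w => Some w
  else fun w => if w == 0 then None else Some w^-1.

Definition in_charts (f : S -> S) (p : S) : C -> C :=
  chart (f p) \o f \o chart_inv p.

(* Given the continuity of f, being complex differentiable at p does not depend
   on the charts chosen at p and f p. *)
Definition holomorphic (f : S -> S) : Prop :=
  continuous f /\ forall p : S, derivable (in_charts f p) (chart p p) 1.

Definition is_cycle (f : S -> S) (T : nat) (O : seq S) : Prop :=
  exists s : S, [/\ O = traject f s T, (0 < T)%N, iter T f s = s &
    forall k : nat, (0 < k < T)%N -> iter k f s <> s].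

(* (f^T)'(s) for T the length of the cycle O and s its first point. As s is
   fixed by f^T, the same chart is used at the source and at the target; for
   s = oo this is the derivative at 0 of f^T conjugated by 1/z. *)
Definition multiplier (f : S -> S) (O : seq S) : C :=
  let s := head None O in derive1 (in_charts (iter (size O) f) s) (chart s s).

Definition unstable (f : S -> S) (O : seq S) : Prop :=
  1 < `|multiplier f O|.

End RiemannSphere.

Section Averaging.
Variable R : realType.
Local Notation C := R[i].

(* The averaging set {a_1, ..., a_n} is the sequence a of size n; its indices
   are shifted: a_j is a`_(j.-1). *)
Definition averaging (a : seq C) : Prop :=
  \sum_(j < size a) a`_j = 1 /\ a`_0 != 0.

Definition p_poly (a : seq C) : {poly C} :=
  \sum_(j < size a) a`_j *: 'X^((size a).-1 - j).

Definition chi_poly (a : seq C) (T : nat) (mu : C) : {poly C} :=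
  'X^((size a).-1 * T + 1) - mu *: p_poly a ^+ T.

Definition q_poly (a : seq C) (T : nat) : {poly C} :=
  \sum_(j < size a) a`_j *: 'X^(j * T + 1).

Definition stabilizes_locally (f : Sphere R -> Sphere R) (a : seq C)
    (O : seq (Sphere R)) : Prop :=
  forall z : C, root (chi_poly a (size O) (multiplier f O)) z -> `|z| < 1.

End Averaging.

(* Main.v *)
(** Under the substitution [u = w ^- T], the equation [chi u = 0] becomes
    [q(w) ^ T = 1 / mu], and the complement of the open unit disk corresponds to
    the punctured closed unit disk; [w = 0] is never a solution. *)
Require Import Defs.
From mathcomp Require Import all_boot all_order all_algebra reals complex.

Local Open Scope ring_scope.

Section AveragingPolynomials.
Variables (R : realType) (a : seq R[i]).
Local Notation C := R[i].

(** [p_poly] lists the coefficients in reverse order, so factoring the top power of [w] out of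
    [q_poly] leaves powers of [w ^- T]. *)
Lemma horner_q_poly (T : nat) (w : C) : w != 0 -> (0 < size a)%N ->
  (q_poly a T).[w] = w ^+ ((size a).-1 * T + 1) * (p_poly a).[w ^- T].
Proof.
move=> w0 a_gt0; rewrite /q_poly /p_poly !horner_sum mulr_sumr.
apply: eq_bigr => j _; rewrite !hornerZ !hornerXn mulrCA; congr (_ * _).
(* This bound makes the truncated subtraction [(size a).-1 - j] exact. *)
have le_j : (j <= (size a).-1)%N by rewrite -ltnS prednK.
have -> : ((size a).-1 * T + 1 = (j * T + 1) + T * ((size a).-1 - j))%N.
  by rewrite -{1}(subnKC le_j) mulnDl addnAC [(T * _)%N]mulnC.
by rewrite (exprD _ (j * T + 1)) -mulrA exprVn -exprM divff ?mulr1 // expf_neq0.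
Qed.

(** Multiplying the value of [chi_poly] at [w ^- T] by [w ^+ (((size a).-1 * T + 1) * T)] turns it
    into [1 - mu * (q_poly a T).[w] ^+ T]. *)
Lemma root_chi_poly (T : nat) (mu w : C) :
  w != 0 -> mu != 0 -> (0 < size a)%N ->
  root (chi_poly a T mu) (w ^- T) = ((q_poly a T).[w] ^+ T == 1 / mu).
Proof.
move=> w0 mu0 a_gt0; rewrite horner_q_poly // rootE /chi_poly.
rewrite hornerD hornerN hornerZ hornerXn horner_exp subr_eq0.
rewrite exprMn exprVn -!exprM [(T * _)%N]mulnC.
have wN0 : w ^+ (((size a).-1 * T + 1) * T) != 0 by rewrite expf_neq0.
rewrite -(inj_eq (mulfI wN0)) divff // mulrCA eq_sym.
by rewrite -(inj_eq (mulfI mu0) _ (1 / mu)) div1r divff.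
Qed.

End AveragingPolynomials.

Theorem theorem2 (R : realType) (f : Sphere R -> Sphere R)
    (f_hol : holomorphic f)
    (T : nat) (O : seq (Sphere R)) (O_cycle : is_cycle f T O)
    (O_unstable : unstable f O)
    (mu : R[i]) (mu_def : multiplier f O = mu)
    (a : seq R[i]) (a_avg : averaging a) :
  stabilizes_locally f a O <->
  ~ (exists z : R[i], `|z| <= 1 /\ (q_poly a T).[z] ^+ T = 1 / mu).
Proof.
have [s [defO T_gt0 _ _]] := O_cycle.
have sizeO : size O = T by rewrite defO size_traject.
have mu0 : mu != 0.
  apply/eqP => mu0; move: O_unstable; rewrite /unstable mu_def mu0.
  by rewrite normr0 ltr10.
have a_gt0 : (0 < size a)%N.
  by case: a_avg => _; case: (a) => //; rewrite eqxx.
rewrite /stabilizes_locally sizeO mu_def.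
split=> [stab [w [w_le1 qw]] | noval u root_u].
  (* All exponents [j * T + 1] are positive, so [q_poly] vanishes at 0, whereas [1 / mu] is
     nonzero. *)
  have w0 : w != 0.
    apply/eqP => w0; move: qw; rewrite w0 /q_poly horner_sum big1.
      by rewrite expr0n gtn_eqF // div1r => /esym/eqP; rewrite invr_eq0 (negPf mu0).
    by move=> j _; rewrite hornerZ hornerXn addn1 expr0n mulr0.
  have /stab : root (chi_poly a T mu) (w ^- T) by rewrite root_chi_poly // qw.
  rewrite normfV normrX invf_lt1 ?exprn_gt0 ?normr_gt0 // => w_gt1.
  by have := lt_le_trans w_gt1 (exprn_ile1 T (normr_ge0 w) w_le1); rewrite ltxx.
(* The order on [R[i]] is partial; negating [<] is sound here because both sides are real. *)
rewrite real_ltNge ?normr_real ?real1 //; apply/negP => u_ge1.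
have u0 : u != 0 by rewrite -normr_gt0 (lt_le_trans ltr01).
have rootK : (T.-root u) ^+ T = u by rewrite rootCK.
have r0 : T.-root u != 0 by rewrite rootC_eq0.
(* The witness solves [w ^- T = u]; any [T]-th root of [u] would serve, all having modulus at least
   1. *)
apply: noval; exists (T.-root u)^-1; split.
  rewrite normfV invf_le1 ?normr_gt0 //.
  by rewrite -(ler_pXn2r T_gt0) ?nnegrE // expr1n -normrX rootK.
by apply/eqP; rewrite -root_chi_poly ?invr_eq0 // exprVn invrK rootK.
Qed.
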